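(* Let $t$ be a positive integer and let $G=(V,E)$ be a simple $k$-connected graph with $k\geq 12t$. Then the matroid $\mathcal{C}^t(G)$ is vertically $(k-6t+1)$-connected.
   Context: Graphs are finite, with no loops and no isolated vertices; ''$k$-connected'' for graphs refers to vertex-connectivity. The cofactor matroid. Let $G=(V,E)$ be a simple graph. A cover of a graph $(V,J)$ is a collection $\mathcal{X}$ of subsets of $V$, each of size at least two, such that every edge in $J$ has both end vertices in some $X\in\mathcal{X}$ (the empty collection is a cover when $J=\varnothing$). It is $2$-thin if $|X\cap Y|\le 2$ for all distinct $X,Y\in\mathcal{X}$. A hinge of a $2$-thin cover $\mathcal{X}$ is a pair of vertices $\{x,y\}$ with $X\cap Y=\{x,y\}$ for two distinct $X,Y\in\mathcal{X}$; $H(\mathcal{X})$ is the set of hinges, and for $h\in H(\mathcal{X})$, $\deg_{\mathcal{X}}(h)$ is the number of sets in $\mathcal{X}$ containing $h$. $\mathcal{X}$ is $4$-shellable if its elements can be ordered as $(X_1,\dots,X_m)$ so that $|X_i\cap\bigcup_{j=1}^{i-1}X_j|\le 4$ for all $2\le i\le m$. The $C_2^1$-cofactor matroid $\mathcal{C}(G)$ is the matroid on $E$ with rank function $$r(E')=\min\Big\{|F|+\sum_{X\in\mathcal{X}}(3|X|-6)-\sum_{h\in H(\mathcal{X})}(\deg_{\mathcal{X}}(h)-1)\Big\}\quad (E'\subseteq E),$$ the minimum being over all $F\subseteq E'$ and all $4$-shellable $2$-thin covers $\mathcal{X}$ of $(V,E'-F)$ with sets of size at least five (this characterization by Clinch,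 Jackson and Tanigawa is taken as the definition). $\mathcal{C}^t(G)$ denotes the union of $t$ copies of $\mathcal{C}(G)$ (independent sets are the unions of $t$ independent sets of $\mathcal{C}(G)$). Vertical connectivity. For a matroid $\mathcal{M}$ on $E$ with rank function $r$ and a positive integer $c$, a bipartition $(E_1,E_2)$ of $E$ is a vertical $c$-separation if $r(E_1),r(E_2)\ge c$ and $r(E_1)+r(E_2)\le r(E)+c-1$. The vertical connectivity of $\mathcal{M}$ is the smallest $c$ for which $\mathcal{M}$ has a vertical $c$-separation, and $r(E)$ if it has no vertical separations at all. $\mathcal{M}$ is vertically $c$-connected if its vertical connectivity is at least $c$. *)

(* Defs.v *)
From HB Require Import structures.
From mathcomp Require Import all_boot all_order all_algebra.
Set Implicit Arguments.
Unset Strict Implicit.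
Unset Printing Implicit Defensive.

Record matroid (T : finType) (E : {set T}) := Matroid {
  indep : {set {set T}};
  indep_ground : forall I, I \in indep -> I \subset E;
  indep0 : set0 \in indep;
  indepS : forall I J : {set T}, J \in indep -> I \subset J -> I \in indep;
  indep_aug : forall I J : {set T}, I \in indep -> J \in indep -> #|I| < #|J| ->
    exists2 x, x \in J :\: I & x |: I \in indep
}.

Definition rank_of (T : finType) (F : {set {set T}}) (A : {set T}) : nat :=
  \max_(I in F | I \subset A) #|I|.

Definition mrank (T : finType) (E : {set T}) (M : matroid E) : {set T} -> nat :=
  rank_of (indep M).

Definition union_indep (T : finType) (E : {set T}) (M : matroid E) (t : nat) :
    {set {set T}} :=
  [set I | [exists J : {ffun 'I_t -> {set T}},
     [forall i, J i \in indep M] && (I == \bigcup_i J i)]].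

Definition vertical_separation (T : finType) (E : {set T}) (r : {set T} -> nat)
    (c : nat) (E1 E2 : {set T}) : bool :=
  [&& E1 :|: E2 == E, [disjoint E1 & E2],
      c <= r E1, c <= r E2 & r E1 + r E2 <= r E + c - 1].

Definition has_vertical_separation (T : finType) (E : {set T})
    (r : {set T} -> nat) (c : nat) : bool :=
  (0 < c) && [exists E1, exists E2, vertical_separation E r c E1 E2].

(* Searching c in 0, ..., r E is enough when r is monotone: see
   has_vertical_separation_le. *)
Definition vertical_connectivity (T : finType) (E : {set T})
    (r : {set T} -> nat) : nat :=
  let cs := iota 0 (r E).+1 in
  if has (has_vertical_separation E r) cs
  then find (has_vertical_separation E r) cs else r E.

Definition vertically_connected (T : finType) (E : {set T})
    (r : {set T} -> nat) (c : nat) : Prop :=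
  c <= vertical_connectivity E r.

Record sgraph := SGraph {
  vertex :> finType;
  adj : rel vertex;
  adj_sym : symmetric adj;
  adj_irrefl : irreflexive adj
}.

Definition edges (G : sgraph) : {set {set G}} :=
  [set [set p.1; p.2] | p in [pred p : G * G | adj p.1 p.2]].

Definition k_connected (G : sgraph) (k : nat) : Prop :=
  k < #|G| /\
  forall S : {set G}, #|S| < k -> forall x y : G, x \notin S -> y \notin S ->
    connect [rel u v | [&& adj u v, u \notin S & v \notin S]] x y.

Definition is_cover (V : finType) (J X : {set {set V}}) : bool :=
  [forall A in X, 2 <= #|A|] && [forall e in J, exists A in X, e \subset A].

Definition two_thin (V : finType) (X : {set {set V}}) : bool :=
  [forall A in X, forall B in X, (A != B) ==> (#|A :&: B| <= 2)].

Definition hinges (V : finType) (X : {set {set V}}) : {set {set V}} :=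
  [set h : {set V} | (#|h| == 2) &&
     [exists A in X, exists B in X, (A != B) && (A :&: B == h)]].

Definition hinge_deg (V : finType) (X : {set {set V}}) (h : {set V}) : nat :=
  #|[set A in X | h \subset A]|.

Definition four_shelling (V : finType) (s : seq {set V}) : bool :=
  [forall i : 'I_(size s), (0 < i) ==>
     (#|nth set0 s i :&: \bigcup_(A <- take i s) A| <= 4)].

Definition four_shellable (V : finType) (X : {set {set V}}) : bool :=
  has (@four_shelling V) (permutations (enum X)).

Definition cofactor_admissible (V : finType) (E' : {set {set V}})
    (FX : {set {set V}} * {set {set V}}) : bool :=
  let: (F, X) := FX in
  [&& F \subset E', is_cover (E' :\: F) X, two_thin X, four_shellable X
    & [forall A in X, 5 <= #|A|]].

Definition cofactor_value (V : finType)
    (FX : {set {set V}} * {set {set V}}) : int :=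
  let: (F, X) := FX in
  (#|F|%:Z + \sum_(A in X) (3 * #|A|%:Z - 6)
    - \sum_(h in hinges X) ((hinge_deg X h)%:Z - 1))%R.

(* The starting point F = E', X = empty of the minimization is admissible: see
   cofactor_admissible0. *)
Definition cofactor_rank (V : finType) (E' : {set {set V}}) : int :=
  cofactor_value
    [arg min_(FX < (E', set0) | cofactor_admissible E' FX)
       cofactor_value FX]%O.

(* The matroid on the edge set whose rank function is cofactor_rank. Such a
   matroid exists for every G (Clinch, Jackson and Tanigawa) and it is unique:
   see cofactor_matroid_unique. *)
Definition is_cofactor_matroid (G : sgraph) (C : matroid (edges G)) : Prop :=
  forall E' : {set {set G}}, E' \subset edges G ->
    (mrank C E')%:Z%R = cofactor_rank E'.

Lemma rank_of_mono (T : finType) (F : {set {set T}}) (A B : {set T}) :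
  A \subset B -> rank_of F A <= rank_of F B.
Proof.
move=> sAB; apply/bigmax_leqP => I /andP[IF sIA].
by apply: (@leq_bigmax_cond _ _ (fun I : {set T} => #|I|));
  rewrite IF (subset_trans sIA).
Qed.

Lemma has_vertical_separation_le (T : finType) (E : {set T})
    (r : {set T} -> nat) (c : nat) :
  {homo r : A B / A \subset B >-> A <= B} ->
  has_vertical_separation E r c -> c <= r E.
Proof.
move=> r_mono /andP[_ /existsP[E1 /existsP[E2 /and5P[/eqP <- _ cE1 _ _]]]].
exact: leq_trans cE1 (r_mono _ _ (subsetUl _ _)).
Qed.

Lemma vertically_connectedP (T : finType) (E : {set T})
    (r : {set T} -> nat) (c : nat) :
  {homo r : A B / A \subset B >-> A <= B} ->
  vertically_connected E r c <->
  c <= r E /\ forall c', c' < c -> ~~ has_vertical_separation E r c'.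
Proof.
move=> r_mono; rewrite /vertically_connected /vertical_connectivity.
set P := has_vertical_separation E r; set cs := iota _ _.
have nthP i : i <= r E -> nth 0 cs i = i by move=> ?; rewrite nth_iota.
case: ifP => [hasP | /hasPn noP]; last first.
  split=> [le_c|[]//]; split=> // c' lt_c'.
  by apply: noP; rewrite mem_iota ltnS /= (leq_trans (ltnW lt_c')).
have lt_find : find P cs <= r E.
  by rewrite -ltnS -[X in _ < X](size_iota 0) -has_find.
have Pfind : P (find P cs) by rewrite -[X in P X]nthP // nth_find.
split=> [le_c | [le_c noP]].
  split=> [|c' lt_c']; first exact: leq_trans lt_find.
  have lt_f := leq_trans lt_c' le_c.
  by rewrite -[c']nthP ?(leq_trans (ltnW lt_f)) //; apply/negbT/before_find.
by rewrite leqNgt; apply: contraL Pfind => /noP.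
Qed.

Lemma cofactor_admissible0 (V : finType) (E' : {set {set V}}) :
  cofactor_admissible E' (E', set0).
Proof.
rewrite /cofactor_admissible subxx setDv; apply/and5P; split=> //.
- by apply/andP; split; apply/forall_inP => A; rewrite inE.
- by apply/forall_inP => A; rewrite inE.
- apply/hasP; exists [::]; first by rewrite mem_permutations enum_set0.
  by apply/forallP => -[].
- by apply/forall_inP => A; rewrite inE.
Qed.

Lemma cofactor_rankP (V : finType) (E' : {set {set V}}) (n : int) :
  cofactor_rank E' = n <->
  (exists2 FX, cofactor_admissible E' FX & cofactor_value FX = n) /\
  forall FX, cofactor_admissible E' FX -> (n <= cofactor_value FX)%R.
Proof.
rewrite /cofactor_rank.
case: Order.TotalTheory.arg_minP => [|FX adm minFX].
  exact: cofactor_admissible0.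
split=> [<- | [[FX' adm' <-] min']]; first by split=> //; exists FX.
by apply: Order.POrderTheory.le_anti; rewrite minFX ?min'.
Qed.

Lemma mem_indep_rank (T : finType) (E : {set T}) (M : matroid E) (I : {set T}) :
  (I \in indep M) = (mrank M I == #|I|).
Proof.
apply/idP/eqP => [MI | rI].
  apply/eqP; rewrite eqn_leq; apply/andP; split.
    by apply/bigmax_leqP => J /andP[_ /subset_leq_card].
  by apply: (@leq_bigmax_cond _ _ (fun I : {set T} => #|I|)); rewrite MI subxx.
have [|J /andP[MJ sJI] rJ] :=
  @eq_bigmax_cond _ [pred J in indep M | J \subset I] (fun J : {set T} => #|J|).
  by apply/card_gt0P; exists set0; rewrite inE /= indep0 sub0set.
suff /eqP <- : J == I by [].
by rewrite eqEcard sJI -rI /mrank /rank_of -rJ leqnn.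
Qed.

Lemma cofactor_matroid_unique (G : sgraph) (C1 C2 : matroid (edges G)) :
  is_cofactor_matroid C1 -> is_cofactor_matroid C2 -> indep C1 = indep C2.
Proof.
move=> cC1 cC2; apply/setP => I.
have [sIE | nIE] := boolP (I \subset edges G).
  rewrite !mem_indep_rank.
  by have [->] := etrans (cC1 I sIE) (esym (cC2 I sIE)).
have out (C : matroid (edges G)) : (I \in indep C) = false.
  by apply: contraNF nIE; apply: indep_ground.
by rewrite !out.
Qed.

(* Main.v *)
(* By the matroid union theorem the two sides of a vertical separation of C^t(G)
   are covered by a set F of edges and two 4-shellable 2-thin families X1, X2
   with |F| + t (val X1 + val X2) <= r(E1) + r(E2). If V belongs to X_i then E_i
   already has the maximal possible rank t(3n - 6). Otherwise
   |F| + t (val X1 + val X2) >= 3tn + k - 12t, which is proved by discharging to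
   the vertices. A vertex in d sets lies on hinges of total excess at most
   0, 0, 1, 3, 6, 9, ... (d = 0, 1, 2, ...), so vertices in several sets have
   some weight to spare, and by k-connectivity each set has at least k boundary
   vertices or consists of fewer than k boundary vertices only. *)
Require Import Defs.
From mathcomp Require Import all_boot all_order all_algebra.
From mathcomp Require Import zify ring lra.
Set Implicit Arguments.
Unset Strict Implicit.
Unset Printing Implicit Defensive.
Import Order.TTheory GRing.Theory Num.Theory.

(** * Matroid partition and matroid union for abstract rank functions *)

Section RankFunctions.
Variable T : finType.
Implicit Types (A B S I : {set T}) (r : {set T} -> nat).

(** Rank axioms instead of the record [matroid]: contractions and uniform matroids come without
    describing their independent sets. *)
Definition rank_fun r :=
  [/\ r set0 = 0, {homo r : A B / A \subset B >-> A <= B},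
      forall x A, r (x |: A) <= (r A).+1
    & forall A B, r (A :|: B) + r (A :&: B) <= r A + r B].

Lemma rank_fun_uniform m : rank_fun (fun A => minn #|A| m).
Proof.
split=> [|A B /subset_leq_card|x A|A B]; first by rewrite cards0 min0n.
- lia.
- by rewrite cardsU1; lia.
- have := cardsUI A B; have := subset_leq_card (subsetIl A B).
  by have := subset_leq_card (subsetIr A B); lia.
Qed.

Lemma rank_fun_contract r e :
  rank_fun r -> rank_fun (fun A => r (e |: A) - r [set e]).
Proof.
case=> r0 rm r1 rs; split=> [|A B sAB|x A|A B].
- by rewrite setU0 subnn.
- by rewrite leq_sub2r // rm // setUS.
- by rewrite setUCA; have := r1 x (e |: A); lia.
- have := rs (e |: A) (e |: B).
  rewrite -setUUr -setUIr.
  have h C : r [set e] <= r (e |: C) by rewrite rm // subsetUl.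
  by have := h A; have := h B; have := h (A :|: B); have := h (A :&: B); lia.
Qed.

(** Closure is monotone: submodularity applied to [e |: A] and [B]. *)
Lemma rank_fun_absorb r e A B :
  rank_fun r -> A \subset B -> r (e |: A) = r A -> r (e |: B) = r B.
Proof.
case=> r0 rm r1 rs sAB rA; apply/eqP.
rewrite eqn_leq [X in _ && X]rm ?subsetUr // andbT.
have := rs (e |: A) B; rewrite rA -setUA (setUidPr sAB).
have : r A <= r ((e |: A) :&: B) by rewrite rm // subsetI sAB subsetUr.
lia.
Qed.

(* The sets [A] with [#|A| = \sum_j r j A] are closed under union. If an element
   [e] of [S] could be put in no class, each [j] would have a tight set whose
   [r j]-span contains [e], and the union of these, with [e], would violate
   the counting condition. *)
Lemma matroid_partition (J : finType) (j0 : J) S (r : J -> {set T} -> nat) :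
  (forall j, rank_fun (r j)) ->
  (forall A, A \subset S -> #|A| <= \sum_j r j A) ->
  exists c : T -> J,
    forall j, r j [set x in S | c x == j] = #|[set x in S | c x == j]|.
Proof.
move: {2}#|S| (erefl #|S|) => n.
elim: n S r => [|n IHn] S r cS rr rS.
  have S0 : S = set0 by apply/eqP; rewrite -cards_eq0 cS.
  exists (fun _ => j0) => j; suff -> : [set x in S | j0 == j] = set0.
    by rewrite cards0; case: (rr j).
  by apply/setP => x; rewrite S0 !inE.
have [e eS] : exists e, e \in S by apply/set0Pn; rewrite -cards_eq0 cS.
set S' := S :\ e.
have cS' : #|S'| = n by move: cS; rewrite (cardsD1 e) eS => -[].
pose tight A := (A \subset S') && (#|A| == \sum_j r j A).
have tightU A B : tight A -> tight B -> tight (A :|: B).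
  move=> /andP[sA /eqP tA] /andP[sB /eqP tB]; apply/andP; split.
    by rewrite subUset sA.
  have sAB : A :|: B \subset S' by rewrite subUset sA.
  have sS : S' \subset S by rewrite subD1set.
  have h1 := rS _ (subset_trans sAB sS).
  have h2 := rS _ (subset_trans (subset_trans (subsetIl A B) sA) sS).
  have h3 : \sum_j r j (A :|: B) + \sum_j r j (A :&: B)
            <= \sum_j r j A + \sum_j r j B.
    rewrite -!big_split; apply: leq_sum => j _.
    by have [_ _ _ ->] := rr j.
  by have := cardsUI A B; lia.
have tight0 : tight set0.
  rewrite /tight sub0set cards0 big1 // => j _.
  by case: (rr j).
have [/existsP[j /andP[/eqP rje /forallP good]] | /existsPn bad] :=
  boolP [exists j, (r j [set e] == 1) &&
    [forall A, tight A ==> (r j (e |: A) != r j A)]].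
  (* Putting [e] in class [j] contracts it in [r j]. This lowers the sum by at most one, and not at
     all on tight sets, so the counting condition survives on [S']. *)
  pose r' i A := if i == j then r j (e |: A) - r j [set e] else r i A.
  have rr' i : rank_fun (r' i).
    by rewrite /r'; case: eqP => // _; apply: rank_fun_contract.
  have rS' A : A \subset S' -> #|A| <= \sum_i r' i A.
    move=> sA; have sAS := subset_trans sA (subD1set S e).
    have := rS _ sAS; rewrite (bigD1 j) //= [X in _ -> _ <= X](bigD1 j) //=.
    rewrite {1}/r' eqxx rje.
    have -> : \sum_(i | i != j) r' i A = \sum_(i | i != j) r i A.
      by apply: eq_bigr => i /negPf nij; rewrite /r' nij.
    have [_ rm _ _] := rr j.
    have : r j A <= r j (e |: A) by rewrite rm // subsetUr.
    have := good A; rewrite /tight sA /= (bigD1 j) //=.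
    by case: eqP => /= [_ /eqP|]; lia.
  have [c hc] := IHn _ _ cS' rr' rS'.
  exists (fun x => if x == e then j else c x) => i.
  have := hc i; rewrite /r'.
  have [-> | nij] := eqVneq i j => hi.
    have -> : [set x in S | (if x == e then j else c x) == j]
              = e |: [set x in S' | c x == j].
      apply/setP => x; rewrite !inE; have [->|] := eqVneq x e => //.
      by rewrite eS eqxx.
    have [_ rm _ _] := rr j.
    have : r j [set e] <= r j (e |: [set x in S' | c x == j]).
      by rewrite rm // subsetUl.
    by rewrite cardsU1 !inE eqxx /=; lia.
  suff -> : [set x in S | (if x == e then j else c x) == i]
            = [set x in S' | c x == i] by [].
  apply/setP => x; rewrite !inE; have [->|] := eqVneq x e => //=.
  by rewrite (eq_sym j) (negPf nij) andbF.
have /fin_all_exists[B hB] j : exists B, tight B /\ r j (e |: B) = r j B.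
  have := bad j; rewrite negb_and => /orP[rj | /forallPn[B]].
    (* Here [e] is a loop of [r j], so the empty tight set already spans it. *)
    exists set0; split=> //; rewrite setU0.
    have [-> _ r1 _] := rr j; have := r1 e set0; rewrite setU0.
    by have [-> _ _ _] := rr j; move: rj; case: (r j _) => [|[|]].
  by rewrite negb_imply negbK => /andP[tB /eqP]; exists B.
pose U := \bigcup_j B j.
have tU : tight U.
  by rewrite /U; elim/big_ind: _ => // j _; case: (hB j).
have rU j : r j (e |: U) = r j U.
  have [_] := hB j; apply: rank_fun_absorb => //.
  exact: (bigcup_sup j).
have /andP[sU /eqP cU] := tU.
have : #|e |: U| <= \sum_j r j (e |: U).
  apply: rS; rewrite subUset sub1set eS.
  by rewrite (subset_trans sU) ?subD1set.
under eq_bigr do rewrite rU.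
rewrite -cU cardsU1; suff -> : e \notin U by lia.
by apply: contraTN sU => eU; apply/subsetPn; exists e => //; rewrite !inE eqxx.
Qed.

(* Apply the partition theorem after adding the uniform matroid of rank
   [max_A (#|A| - \sum_j r j A)]. *)
Lemma matroid_union (J : finType) S (r : J -> {set T} -> nat) :
  (forall j, rank_fun (r j)) ->
  exists2 P : J -> {set T}, forall j, P j \subset S /\ r j (P j) = #|P j|
  & exists2 A : {set T}, A \subset S
    & #|S :\: A| + \sum_j r j A <= #|\bigcup_j P j|.
Proof.
move=> rr.
pose def A := #|A| - \sum_j r j A.
have [A sA maxA] := @arg_maxnP _ set0 (fun A => A \subset S) def (sub0set S).
pose r' o := if o is Some j then r j else fun B => minn #|B| (def A).
have rr' o : rank_fun (r' o).
  by case: o => [j|] //=; apply: rank_fun_uniform.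
have [|c hc] := matroid_partition None rr' (S := S).
  move=> B sB; rewrite (bigD1 None) //= (reindex_omap Some id) => [|[]] //=.
  under eq_bigl do rewrite eqxx.
  by have := maxA _ sB; rewrite /def; lia.
pose P o := [set x in S | c x == o].
exists (fun j => P (Some j)) => [j|].
  by split; [apply/subsetP => x; rewrite inE => /andP[] | apply: (hc (Some j))].
have cover : S = P None :|: \bigcup_j P (Some j).
  apply/setP => x; rewrite inE; apply/idP/orP => [xS|].
    case cx: (c x) => [j|]; [right | left]; last by rewrite inE xS cx eqxx.
    by apply/bigcupP; exists j => //; rewrite inE xS cx eqxx.
  by case=> [|/bigcupP[j _]]; rewrite inE => /andP[].
have cP : #|P None| <= def A by rewrite -[#|_|](hc None) /= geq_minr.
have := leq_card_setU (P None) (\bigcup_j P (Some j)); rewrite -cover => -[cS _].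
(* [def] is a truncated difference. If it is zero, class [None] is empty and [set0] is the witness;
   if it is positive, it is the true difference at [A]. *)
have [def0 | def_gt0] := posnP (def A).
  exists set0; first exact: sub0set.
  rewrite setD0 big1 => [|j _]; first by move: cP cS; rewrite def0; lia.
  by case: (rr j).
exists A => //; have := cardsID A S; rewrite (setIidPr sA).
by move: cP def_gt0; rewrite /def; lia.
Qed.

End RankFunctions.

(** * Rank in a matroid and in a union of its copies *)

Section MatroidRank.
Variables (T : finType) (E : {set T}) (M : matroid E).
Implicit Types (A B I : {set T}).

Lemma leq_rank_of (F : {set {set T}}) I A :
  I \in F -> I \subset A -> #|I| <= rank_of F A.
Proof.
move=> IF sIA.
by apply: (@leq_bigmax_cond _ _ (fun I : {set T} => #|I|)); rewrite IF.
Qed.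

Lemma mrank_basis I A : I \in indep M -> I \subset A ->
  exists2 B, B \in indep M & [/\ I \subset B, B \subset A & #|B| = mrank M A].
Proof.
move=> MI sIA.
pose P B := [&& B \in indep M, I \subset B & B \subset A].
have PI : P I by rewrite /P MI subxx.
have [B /and3P[MB sIB sBA] maxB] := @arg_maxnP _ I P (fun B => #|B|) PI.
exists B => //; split=> //; apply/eqP; rewrite eqn_leq leq_rank_of //=.
apply/bigmax_leqP => C /andP[MC sCA]; rewrite leqNgt; apply/negP => ltBC.
have [x /setDP[xC xB] MxB] := indep_aug MB MC ltBC.
have := maxB (x |: B); rewrite /P MxB subUset sub1set (subsetP sCA) // sBA.
by rewrite (subset_trans sIB) ?subsetUr // cardsU1 xB => /(_ isT); rewrite /geq /= add1n ltnn.
Qed.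

Lemma mrank_rank_fun : rank_fun (mrank M).
Proof.
have le_card A : mrank M A <= #|A|.
  by apply/bigmax_leqP => B /andP[_ /subset_leq_card].
split.
- by apply/eqP; rewrite -leqn0 -(cards0 T) le_card.
- exact: rank_of_mono.
- move=> x A; apply/bigmax_leqP => B /andP[MB sB].
  have := cardsD1 x B; have : #|B :\ x| <= mrank M A.
    by rewrite leq_rank_of ?(indepS MB) ?subD1set // subDset.
  by case: (x \in B) => /=; lia.
(* Submodularity: a basis [I] of the intersection is extended to a basis [K] of the union, and [K]
   is then restricted to [A] and to [B]. *)
- move=> A B; have [I MI [_ sI cI]] := mrank_basis (indep0 M) (sub0set (A :&: B)).
  have sIU : I \subset A :|: B.
    exact: subset_trans sI (subset_trans (subsetIl _ _) (subsetUl _ _)).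
  have [K MK [sIK sK cK]] := mrank_basis MI sIU.
  have KA : #|K :&: A| <= mrank M A.
    by rewrite leq_rank_of ?subsetIr // (indepS MK) ?subsetIl.
  have KB : #|K :&: B| <= mrank M B.
    by rewrite leq_rank_of ?subsetIr // (indepS MK) ?subsetIl.
  have := cardsUI (K :&: A) (K :&: B).
  rewrite -setIUr (setIidPl sK) -setIIr -cI -cK.
  have : #|I| <= #|K :&: (A :&: B)| by rewrite subset_leq_card // subsetI sIK.
  by lia.
Qed.

(** The lower bound in the matroid union formula, for [t] equal summands. *)
Lemma union_rank_ge t A :
  exists2 B : {set T}, B \subset A &
    #|A :\: B| + t * mrank M B <= rank_of (union_indep M t) A.
Proof.
have [P PA [B sBA cB]] := matroid_union A (fun _ : 'I_t => mrank_rank_fun).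
exists B => //; move: cB; rewrite sum_nat_const card_ord => /leq_trans -> //.
apply: leq_rank_of; last by apply/bigcupsP => j _; case: (PA j).
rewrite inE; apply/existsP; exists [ffun j => P j].
apply/andP; split; last by apply/eqP/eq_bigr => j _; rewrite ffunE.
apply/forallP => j; rewrite ffunE mem_indep_rank.
by apply/eqP; case: (PA j).
Qed.

Lemma union_rank_le t A : rank_of (union_indep M t) A <= t * mrank M A.
Proof.
apply/bigmax_leqP => I /andP[]; rewrite inE => /existsP[P /andP[/forallP MP /eqP ->]].
move=> /bigcupsP sP; apply: (@leq_trans (\sum_j #|P j|)).
  elim/big_rec2: _ => [|j n S _ le_nS]; first by rewrite cards0.
  by rewrite (leq_trans (leq_card_setU _ _)) // leq_add2l.
rewrite -[t in t * _]card_ord -sum_nat_const.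
by apply: leq_sum => j _; rewrite leq_rank_of ?sP.
Qed.

End MatroidRank.

(** * Hinge excess at a vertex *)

Section Hinges.
Variable V : finType.
Implicit Types (A B h : {set V}) (X : {set {set V}}) (s : seq {set V}).

(* [hinge_cap d] is [0, 0, 1, 3, 6, 9, ...] for [d = 0, 1, 2, ...]. *)
Definition hinge_cap d := \sum_(i < d) minn i 3.

Lemma hinge_capS d : hinge_cap d.+1 = hinge_cap d + minn d 3.
Proof. by rewrite /hinge_cap big_ord_recr. Qed.

(** The increments [minn i 3] are nondecreasing. Superadditivity lets the bounds from several covers
    be merged into one for the total number of sets at a vertex. *)
Lemma hinge_cap_add a b : hinge_cap a + hinge_cap b <= hinge_cap (a + b).
Proof.
elim: b => [|b IHb]; first by rewrite /hinge_cap big_ord0 !addn0.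
by rewrite addnS !hinge_capS; lia.
Qed.

Lemma hinge_cap_sum (J : finType) (d : J -> nat) :
  \sum_j hinge_cap (d j) <= hinge_cap (\sum_j d j).
Proof.
elim/big_rec2: _ => [|j a b _ le_ab]; first by rewrite /hinge_cap big_ord0.
by apply: leq_trans (hinge_cap_add _ _); rewrite leq_add2l.
Qed.

Lemma hinge_cap_ge3 d : hinge_cap d.+3 = 3 * d.+1.
Proof.
elim: d => [|d IHd]; first by rewrite !hinge_capS /hinge_cap big_ord0.
by rewrite hinge_capS IHd; lia.
Qed.

Lemma four_shelling_rcons s A :
  four_shelling (rcons s A) ->
  four_shelling s /\ #|A :&: \bigcup_(B <- s) B| <= 4.
Proof.
move=> /forallP shA; split.
  apply/forallP => i; have lt_i : i < size (rcons s A) by rewrite size_rcons ltnS ltnW.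
  have := shA (Ordinal lt_i); rewrite /= nth_rcons ltn_ord -cats1 take_cat.
  by rewrite ltn_ord.
have [/size0nil -> | s_gt0] := posnP (size s).
  by rewrite big_nil setI0 cards0.
have lt_s : size s < size (rcons s A) by rewrite size_rcons.
have := shA (Ordinal lt_s); rewrite /= nth_rcons ltnn eqxx -cats1 s_gt0.
by rewrite take_size_cat.
Qed.

(* Among the sets containing [v], the [i]-th meets the union of the previous
   ones, outside [v], in at most [minn i 3] vertices: at most one for each
   previous set because the cover is 2-thin, and at most three because of the
   shelling. *)
Lemma link_excess s v :
  four_shelling s -> pairwise (fun A B => #|A :&: B| <= 2) s ->
  \sum_(w | w != v) (count (fun A => (v \in A) && (w \in A)) s).-1
  <= hinge_cap (count (fun A => v \in A) s).
Proof.
elim/last_ind: s => [|s A IHs]; first by rewrite big1.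
move=> /four_shelling_rcons[sh_s sh_A]; rewrite pairwise_rcons => /andP[thA th_s].
have {IHs} := IHs sh_s th_s; rewrite -cats1 count_cat /= addn0.
under [X in _ -> X <= _]eq_bigr do rewrite count_cat /= addn0.
have [vA | vA] /= := boolP (v \in A); last first.
  by rewrite addn0; under [X in _ -> X <= _]eq_bigr do rewrite addn0.
set d := count (fun A => v \in A) s; pose c w := count (fun A => (v \in A) && (w \in A)) s.
rewrite -/(c _) => IHs.
rewrite addn1 hinge_capS.
(* The vertices at which adding [A] raises the truncated count. *)
pose N := [set w in A | (w != v) && (0 < c w)].
have -> : \sum_(w | w != v) (c w + (w \in A)).-1 =
          \sum_(w | w != v) (c w).-1 + #|N|.
  rewrite -sum1_card [X in _ + X]big_mkcond [X in _ + X]big_mkcond /=.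
  rewrite [X in _ + X](bigD1 v) //= inE eqxx andbF add0n -big_split /=.
  apply: eq_bigr => w /negPf wv; rewrite inE wv /=.
  by case: (w \in A) => /=; case: (c w) => //= *; lia.
apply: leq_add IHs _.
rewrite leq_min; apply/andP; split.
  rewrite /N -sum1dep_card.
  apply: (@leq_trans (\sum_(w | (w \in A) && (w != v)) c w)).
    rewrite big_mkcondr [X in _ <= X]big_mkcond [X in X <= _]big_mkcond.
    apply: leq_sum => w _; case: (w \in A) => //=.
    by case: (w != v) => //=; case: (c w).
  under eq_bigr => w _ do rewrite /c -sum1_count big_mkcondr.
  rewrite exchange_big /= /d -sum1_count big_seq_cond [X in _ <= X]big_seq_cond.
  apply: leq_sum => B /andP[/(allP thA) thB vB].
  rewrite -big_mkcondr sum1dep_card.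
  have := cardsD1 v (B :&: A); rewrite inE vB vA.
  suff -> : [set x | (x \in A) && (x != v) & x \in B] = (B :&: A) :\ v by lia.
  by apply/setP => w; rewrite !inE; case: (w \in A); case: (w \in B); case: (w == v).
have in_union w : 0 < c w -> (v \in \bigcup_(B <- s) B) && (w \in \bigcup_(B <- s) B).
  rewrite -has_count => /hasP[B Bs /andP[vB wB]].
  have sB : B \subset \bigcup_(B <- s) B by rewrite (big_rem B) //= subsetUl.
  by rewrite !(subsetP sB).
have [-> | [w]] := set_0Vmem N; first by rewrite cards0.
rewrite inE => /and3P[_ _ /in_union/andP[vU _]].
have sN : v |: N \subset A :&: \bigcup_(B <- s) B.
  rewrite subUset sub1set inE vA vU; apply/subsetP => u.
  by rewrite !inE => /and3P[-> _ /in_union/andP[_ ->]].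
have := leq_trans (subset_leq_card sN) sh_A.
by rewrite cardsU1 !inE eqxx andbF.
Qed.

(** A hinge at [v] is determined by its other end [w], and its degree counts the sets containing
    both, so [link_excess] applies. *)
Lemma hinge_excess X v : two_thin X -> four_shellable X ->
  \sum_(h in hinges X | v \in h) (hinge_deg X h).-1
  <= hinge_cap #|[set A in X | v \in A]|.
Proof.
move=> /forall_inP thin /hasP[s]; rewrite mem_permutations => perm_s sh_s.
have uniq_s : uniq s by rewrite (perm_uniq perm_s) enum_uniq.
have mem_s A : (A \in s) = (A \in X) by rewrite (perm_mem perm_s) mem_enum.
have countX (P : pred {set V}) : #|[set A in X | P A]| = count P s.
  rewrite -size_filter -(card_uniqP (filter_uniq P uniq_s)).
  by apply: eq_card => A; rewrite !inE mem_filter mem_s andbC.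
have thin_s : pairwise (fun A B => #|A :&: B| <= 2) s.
  move: uniq_s; rewrite uniq_pairwise; apply: sub_in_pairwise (allss s).
  move=> A B; rewrite !mem_s => AX BX /= neqAB.
  by have /forall_inP/(_ B BX)/implyP := thin A AX; apply.
rewrite countX; apply: leq_trans (link_excess v sh_s thin_s).
have inj : {in [pred w | w != v] &, injective (fun w => [set v; w])}.
  move=> w1 w2 /= nw1 nw2 /setP/(_ w1); rewrite !inE eqxx orbT.
  by rewrite (negPf nw1) => /esym/eqP.
apply: (@leq_trans (\sum_(h in [set [set v; w] | w in [pred w | w != v]])
                      (hinge_deg X h).-1)).
  rewrite big_mkcond [X in _ <= X]big_mkcond; apply: leq_sum => h _.
  case: andP => [[hX vh]|_]; last by case: ifP.
  move: hX; rewrite inE => /andP[/cards2P h2 _]; case: h2 vh => a [b [nab ->]]; rewrite !inE => vab.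
  case: imsetP => // -[]; case/orP: vab nab => /eqP <- nab.
    by exists b; rewrite // inE eq_sym.
  by exists a; rewrite ?inE 1?setUC.
rewrite big_imset //=; apply: leq_sum => w nwv.
rewrite /hinge_deg countX; rewrite (eq_count (a2 := fun A => (v \in A) && (w \in A))) //.
by move=> A; rewrite subUset !sub1set.
Qed.
End Hinges.

(** * Boundaries and degrees in a $k$-connected graph *)

Section Connectivity.
Variables (G : sgraph) (k : nat).
Implicit Types (A : {set G}) (u v w : G).

Definition boundary A := [set v in A | [exists w, adj v w && (w \notin A)]].

Lemma boundary_sub A : boundary A \subset A.
Proof. by apply/subsetP => v; rewrite inE => /andP[]. Qed.

Lemma boundaryI A v w : v \in A -> adj v w -> w \notin A -> v \in boundary A.
Proof. by move=> vA vw wA; rewrite inE vA; apply/existsP; exists w; rewrite vw. Qed.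

Hypothesis kG : k_connected G k.

(** Fewer than [k] boundary vertices cannot separate an interior vertex of [A] from a vertex outside
    [A], so there is no interior vertex. *)
Lemma boundary_small A : A != setT -> #|boundary A| < k -> boundary A = A.
Proof.
rewrite -subTset => /subsetPn[y _ yA] ltk; apply/eqP; rewrite eqEsubset boundary_sub /=.
apply/subsetP => x xA; apply: contraT => xB.
have yB : y \notin boundary A by apply: contra yA; apply/subsetP/boundary_sub.
have [_ /(_ _ ltk _ _ xB yB) xy] := kG.
have cl : closed [rel u v | [&& adj u v, u \notin boundary A & v \notin boundary A]] (mem A).
  move=> u v /= /and3P[uv uB vB]; apply/idP/idP => [uA|vA].
    by apply: contraR uB; apply: boundaryI uv.
  by apply: contraR vB; apply: boundaryI => //; rewrite adj_sym.
by have := closed_connect cl xy; rewrite xA (negPf yA).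
Qed.

(** Otherwise the neighbours of [v] would separate it from a vertex [y] that is neither [v] nor
    adjacent to it. *)
Lemma k_connected_degree v : k <= #|[set w | adj v w]|.
Proof.
rewrite leqNgt; apply/negP => ltk; have [ltG /(_ _ ltk) conn] := kG.
have /subsetPn[y _ yB] : ~~ (setT \subset v |: [set w | adj v w]).
  rewrite subTset.
  apply: contraTneq ltG => eqT; rewrite -leqNgt -cardsT -eqT cardsU1.
  by case: (_ \notin _) => //=; lia.
move: yB; rewrite !inE negb_or => /andP[yv vy].
have := conn v y; rewrite !inE adj_irrefl vy => /(_ isT isT) xy.
have cl : closed [rel u w | [&& adj u w, u \notin [set w | adj v w]
                   & w \notin [set w | adj v w]]] (pred1 v).
  move=> u w /= /and3P[uw uS wS]; rewrite !inE in uS wS *.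
  have [uv|_] := eqVneq u v; first by move: wS; rewrite -uv uw.
  by have [wv|_] := eqVneq w v; first by move: uS; rewrite -wv adj_sym uw.
by have := closed_connect cl xy; rewrite !inE eqxx (negPf yv).
Qed.

End Connectivity.

(** * Sets and free edges at a vertex of a covered graph *)

Section CoverCount.
Variables (G : sgraph) (k t : nat) (J : finType).
Variables (X : J -> {set {set G}}) (F : {set {set G}}).
Implicit Types (A : {set G}) (u v w : G) (p : J * {set G}).
Hypotheses (t_gt0 : 0 < t) (le_tk : 12 * t <= k) (kG : k_connected G k).
Hypothesis X_thin : forall j, two_thin (X j).
Hypothesis X_shell : forall j, four_shellable (X j).
Hypothesis X_ge5 : forall j A, A \in X j -> 5 <= #|A|.
Hypothesis X_proper : forall j A, A \in X j -> A != setT.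
Hypothesis F_edges : F \subset edges G.
Hypothesis XF_cover : forall e, e \in edges G -> e \notin F ->
  exists2 p, p.2 \in X p.1 & e \subset p.2.

(** Pairs keep apart equal sets that come from different covers [X j]. *)
Definition members : {set J * {set G}} := [set p | p.2 \in X p.1].
Definition at_vertex v : {set J * {set G}} := [set p in members | v \in p.2].
Definition big A := k <= #|boundary A|.
Definition fdeg v := #|[set e in F | v \in e]|.
Definition excess v :=
  \sum_j \sum_(h in hinges (X j) | v \in h) (hinge_deg (X j) h).-1.

Lemma excess_le v : excess v <= hinge_cap #|at_vertex v|.
Proof.
apply: (@leq_trans (\sum_j hinge_cap #|[set A in X j | v \in A]|)).
  by apply: leq_sum => j _; apply: hinge_excess.
apply: leq_trans (hinge_cap_sum _) _.
suff -> : \sum_j #|[set A in X j | v \in A]| = #|at_vertex v| by [].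
under eq_bigr do rewrite -sum1dep_card.
rewrite pair_big_dep -sum1dep_card; apply: eq_bigl => p.
by rewrite inE.
Qed.

Lemma small_boundary p : p \in members -> ~~ big p.2 ->
  boundary p.2 = p.2 /\ #|p.2| < k.
Proof.
rewrite inE => pX; rewrite -ltnNge => ltk.
by have e := boundary_small kG (X_proper pX) ltk; rewrite -{3}e.
Qed.

Lemma edgeP u v : adj u v -> [set u; v] \in edges G.
Proof. by move=> uv; apply/imsetP; exists (u, v). Qed.

Lemma nbr_cover v w : adj v w -> [set v; w] \notin F ->
  exists2 p, p \in at_vertex v & w \in p.2.
Proof.
move=> /edgeP vwE /(XF_cover vwE)[p pX]; rewrite subUset !sub1set => /andP[vp wp].
by exists p => //; rewrite !inE pX.
Qed.

Definition free_nbrs v := [set w | adj v w & [set v; w] \in F].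

Lemma free_nbrs_le v : #|free_nbrs v| <= fdeg v.
Proof.
rewrite /fdeg -(card_in_imset (f := fun w => [set v; w])).
  apply: subset_leq_card; apply/subsetP => e /imsetP[w].
  by rewrite !inE => /andP[_ wF] ->; rewrite wF !inE eqxx.
move=> w1 w2; rewrite !inE => /andP[v1 _] /andP[v2 _] /setP/(_ w1).
rewrite !inE eqxx orbT; case: eqVneq => [w1v|_ /esym/eqP//].
by move: v1; rewrite w1v adj_irrefl.
Qed.

(** Each neighbour of [v] is joined to it by an edge of [F] or lies with it in a set of some
    cover. *)
Lemma degree_cover v : k <= fdeg v + \sum_(p in at_vertex v) #|p.2|.-1.
Proof.
apply: leq_trans (k_connected_degree kG v) _.
have sub : [set w | adj v w] \subset
    free_nbrs v :|: \bigcup_(p in at_vertex v) (p.2 :\ v).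
  apply/subsetP => w; rewrite !inE => vw; rewrite vw /=.
  have [//|/(nbr_cover vw)[p pv wp]] := boolP (_ \in F).
  apply/bigcupP; exists p; rewrite // !inE wp andbT.
  by apply: contraTneq vw => ->; rewrite adj_irrefl.
apply: leq_trans (subset_leq_card sub) _.
apply: leq_trans (leq_card_setU _ _) _; rewrite leq_add ?free_nbrs_le //.
apply: (@leq_trans (\sum_(p in at_vertex v) #|p.2 :\ v|)).
  elim/big_rec2: _ => [|p n S _ le_nS]; first by rewrite cards0.
  by rewrite (leq_trans (leq_card_setU _ _)) // leq_add2l.
apply: leq_sum => p; rewrite inE => /andP[_ vp].
by have := cardsD1 v p.2; rewrite vp; lia.
Qed.

(** * Lower bounds for the surplus of a vertex *)

Local Open Scope ring_scope.
Local Notation T := (t%:R : rat).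
Local Notation K := (k%:R : rat).

(* A set [A] has value [3 #|A| - 6], which is [3] per vertex minus a debt of [6]
   shared among its boundary vertices. When the boundary has at least [k >= 12 t]
   vertices each of them pays [1 / 2], at least its share after scaling by [t];
   otherwise the boundary is [A] itself. *)
Definition due A v : rat :=
  if v \in boundary A then (if big A then 1 / 2 else 6 * T / #|A|%:R) else 0.

(* The contribution of [v] to [|F| + t val(X)], minus [3 t], when every edge and
   every hinge is split evenly between its two ends. *)
Definition surplus v : rat :=
  (fdeg v)%:R / 2 - 3 * T + \sum_(p in at_vertex v) (3 * T - due p.2 v)
  - T / 2 * (excess v)%:R.

Lemma T_ge1 : 1 <= T. Proof. by rewrite ler1n. Qed.

Lemma K_ge : 12 * T <= K.
Proof. by rewrite -natrM ler_nat. Qed.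

Lemma TK_bounds : [/\ 0 <= T / K, T / K <= 1 / 12 & T = T / K * K].
Proof.
have T1 := T_ge1; have KT := K_ge; have K0 : 0 < K by lra.
split; first by rewrite divr_ge0 //; lra.
  by rewrite ler_pdivrMr //; lra.
by rewrite divfK //; lra.
Qed.

(** The worst case is a small set with only five vertices. *)
Lemma due_le p v : p \in members -> due p.2 v <= 6 / 5 * T.
Proof.
rewrite inE => /X_ge5 p5; have T1 := T_ge1; rewrite /due.
case: ifP => _; last lra.
case: ifP => _; first lra.
have P5 : 5 <= #|p.2|%:R :> rat by rewrite ler_nat.
by rewrite ler_pdivrMr; nra.
Qed.

Lemma at_members v p : p \in at_vertex v -> p \in members.
Proof. by rewrite inE => /andP[]. Qed.

Lemma sum_due_le v :
  \sum_(p in at_vertex v) due p.2 v <= 6 / 5 * T * #|at_vertex v|%:R.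
Proof.
rewrite mulr_natr -sumr_const; apply: ler_sum => p /at_members.
exact: due_le.
Qed.

Lemma sum_due_le1 v p : p \in at_vertex v ->
  \sum_(p in at_vertex v) due p.2 v <= due p.2 v + 6 / 5 * T * (#|at_vertex v|%:R - 1).
Proof.
move=> pv; rewrite (big_setD1 p) //= lerD2l.
rewrite (cardsD1 p) pv natrD [1 + _]addrC addrK mulr_natr -sumr_const.
by apply: ler_sum => q /setD1P[_ /at_members]; apply: due_le.
Qed.

Lemma surplusE v :
  surplus v = (fdeg v)%:R / 2 + 3 * T * (#|at_vertex v|%:R - 1)
    - T / 2 * (excess v)%:R - \sum_(p in at_vertex v) due p.2 v.
Proof. by rewrite /surplus sumrB sumr_const -mulr_natr; ring. Qed.

(** For [d >= 3] sets the hinge cap is [3 * d - 6], which costs [3 / 2 * T * d - 3 * T]. At [d = 2]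
    the cap is 1 instead of 0, whence the correction [T / 2]. *)
Lemma surplus_ge v : (2 <= #|at_vertex v|)%N ->
  (fdeg v)%:R / 2 + 3 / 2 * T * #|at_vertex v|%:R
    - (if #|at_vertex v| == 2 then T / 2 else 0)
    - \sum_(p in at_vertex v) due p.2 v <= surplus v.
Proof.
move=> d2; have T1 := T_ge1; rewrite surplusE.
have : T / 2 * (excess v)%:R <= T / 2 * (hinge_cap #|at_vertex v|)%:R.
  by rewrite ler_wpM2l ?ler_nat ?excess_le //; lra.
case: #|at_vertex v| d2 => [|[|[|d]]] // _.
  rewrite (_ : hinge_cap 2 = 1%N); last by rewrite !hinge_capS /hinge_cap big_ord0.
  by rewrite eqxx; lra.
rewrite hinge_cap_ge3 natrM -!(natr1 d.+2) -(natr1 d.+1) -(natr1 d) /=.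
lra.
Qed.

(** Of the [3 / 2 * T] per set, dues take at most [6 / 5 * T]; the rest from two sets still pays the
    correction [T / 2]. *)
Lemma surplus_ge_free v : (2 <= #|at_vertex v|)%N -> (fdeg v)%:R / 2 <= surplus v.
Proof.
move=> d2; have := surplus_ge d2; have := sum_due_le v; have T1 := T_ge1.
have : 2 <= #|at_vertex v|%:R :> rat by rewrite ler_nat.
case: eqP => [->|/eqP d_neq2]; first lra.
by have : 3 <= #|at_vertex v|%:R :> rat by [rewrite ler_nat; lia]; nra.
Qed.

Definition small_at v := [forall p in at_vertex v, ~~ big p.2].

Lemma small_due v p : p \in at_vertex v -> ~~ big p.2 ->
  due p.2 v = 6 * T / #|p.2|%:R.
Proof.
rewrite inE => /andP[pX vp] sp; have [e _] := small_boundary pX sp.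
by rewrite /due e vp (negPf sp).
Qed.

(** The factor serves vertices in at most one set: there the degree bound makes [fdeg v] so large
    that the fraction [12 * (T / K)] of its half absorbs the negative terms. *)
Lemma surplus_small_free v : small_at v ->
  (1 - 12 * (T / K)) * ((fdeg v)%:R / 2) <= surplus v.
Proof.
move=> /forall_inP small_v; have T1 := T_ge1; have KT := K_ge.
have [u0 u1 Tu] := TK_bounds; set u := T / K in u0 u1 Tu *.
have f0 : 0 <= (fdeg v)%:R :> rat by [].
have [d2|] := leqP 2 #|at_vertex v|.
  by apply: le_trans (surplus_ge_free d2); nra.
have := degree_cover v.
case d_eq: #|at_vertex v| => [|[|//]] deg _.
  have at0 : at_vertex v = set0 by apply/eqP; rewrite -cards_eq0 d_eq.
  have e0 : excess v = 0%N.
    apply/eqP; rewrite -leqn0; apply: leq_trans (excess_le v) _.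
    by rewrite d_eq /hinge_cap big_ord0.
  move: deg; rewrite surplusE e0 d_eq at0 !big_set0 addn0 -(ler_nat rat).
  nra.
have /eqP/cards1P[p at1] := d_eq.
have pv : p \in at_vertex v by rewrite at1 set11.
have e0 : excess v = 0%N.
  apply/eqP; rewrite -leqn0; apply: leq_trans (excess_le v) _.
  by rewrite d_eq hinge_capS /hinge_cap big_ord0.
move: deg; rewrite surplusE e0 d_eq at1 !big_set1 (small_due pv) ?small_v //.
have pX := at_members pv; have [_ ltk] := small_boundary pX (small_v p pv).
have /X_ge5 p5 : p.2 \in X p.1 by move: pX; rewrite inE.
move=> deg; have : (k + 1 <= fdeg v + #|p.2|)%N by lia.
rewrite -(ler_nat rat) !natrD.
have P5 : 5 <= #|p.2|%:R :> rat by rewrite ler_nat.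
have PK : #|p.2|%:R + 1 <= K by rewrite natr1 ler_nat.
move: #|p.2|%:R (fdeg v)%:R f0 P5 PK => y f f0 P5 PK fy.
have : 6 * T / y <= 6 * u * f; last nra.
rewrite ler_pdivrMr; last lra.
(* The aim is [K <= f * y]: as [f >= K + 1 - y], the product is at least
   [y * (K + 1 - y) = K + (y - 1) * (K - y)]. *)
have h1 : 0 <= (y - 1) * (K - y) by rewrite mulr_ge0; lra.
have h2 : 0 <= y * (f + y - K - 1) by rewrite mulr_ge0; lra.
have h3 : 0 <= u * (f * y - K) by rewrite mulr_ge0; lra.
by lra.
Qed.

(** A small set has fewer than [k] vertices, so it contains at most [k - 2] neighbours of [v]. *)
Lemma fdeg_ge2 v : small_at v -> (#|at_vertex v| <= 1)%N -> (2 <= fdeg v)%N.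
Proof.
move=> /forall_inP small_v d1; have := degree_cover v.
suff : (\sum_(p in at_vertex v) #|p.2|.-1 <= k - 2)%N by lia.
apply: (@leq_trans (#|at_vertex v| * (k - 2))); last first.
  by rewrite -[X in (_ <= X)%N]mul1n leq_mul2r d1 orbT.
rewrite -sum_nat_const; apply: leq_sum => p pv.
have [_] := small_boundary (at_members pv) (small_v p pv); move: #|p.2| => y yk. lia.
Qed.

Lemma surplus_small v : small_at v -> 1 - 12 * (T / K) <= surplus v.
Proof.
move=> sv; have T1 := T_ge1; have [u0 u1 Tu] := TK_bounds.
have := surplus_small_free sv; set u := T / K in u0 u1 Tu *.
have [f2 _|] := leqP 2 (fdeg v).
  have F2 : 2 <= (fdeg v)%:R :> rat by rewrite ler_nat.
  have [/surplus_ge_free|/(fdeg_ge2 sv) _] := leqP 2 #|at_vertex v|; first lra.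
  have := surplus_small_free sv; rewrite -/u; nra.
move=> f1 _; have d2 : (2 <= #|at_vertex v|)%N.
  by rewrite leqNgt; apply: contraL f1 => /(fdeg_ge2 sv); rewrite -leqNgt.
have f0 : 0 <= (fdeg v)%:R :> rat by [].
have := surplus_ge d2.
(* With at most one edge of [F] at [v], its [d] sets must cover [k - 1] neighbours, so one of them
   has at least [k / d] vertices and a due of at most [6 * (T / K) * d]. *)
have [p pv yk] : exists2 p, p \in at_vertex v & (k <= #|at_vertex v| * #|p.2|)%N.
  apply/exists_inP; apply: contraT => /exists_inPn le_k.
  have : (\sum_(p in at_vertex v) #|at_vertex v| * #|p.2|.-1
          <= \sum_(p in at_vertex v) (k - 2))%N.
    by apply: leq_sum => p /le_k; nia.
  rewrite -big_distrr sum_nat_const /= leq_pmul2l; last exact: ltnW.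
  move: (degree_cover v); move: (\sum_(p in _) _)%N => S; lia.
have := sum_due_le1 pv; rewrite (small_due pv); last exact: (forall_inP sv).
have := sum_due_le v.
have : 6 * T / #|p.2|%:R <= 6 * u * #|at_vertex v|%:R.
  have y0 : (0 < #|p.2|)%N by nia.
  rewrite ler_pdivrMr ?ltr0n //.
  have := ler_wpM2l u0 (_ : K <= (#|at_vertex v| * #|p.2|)%:R); rewrite ler_nat.
  by move=> /(_ yk); rewrite natrM; lra.
(* Two or three sets rely on the large set just found; from four sets on, the remaining [3 / 10 * T]
   per set exceeds 1. *)
have [->|/eqP d_neq2] := eqP; first lra.
have [->|d_neq3] := eqVneq #|at_vertex v| 3%N; first lra.
have : 4 <= #|at_vertex v|%:R :> rat by rewrite ler_nat; lia.
nra.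
Qed.

Lemma surplus_shared v : (2 <= #|at_vertex v|)%N ->
  (1 - 12 * (T / K)) / 2 <= surplus v.
Proof.
move=> d2; have T1 := T_ge1; have [u0 u1 Tu] := TK_bounds.
have [/surplus_small|/forall_inPn[p pv /negPn bp]] := boolP (small_at v); first lra.
have := surplus_ge d2; have := sum_due_le1 pv.
have f0 : 0 <= (fdeg v)%:R :> rat by [].
have : due p.2 v <= 1 / 2 by rewrite /due bp; case: ifP => _ //; lra.
have [->|/eqP d_neq2] := eqP; first lra.
have : 3 <= #|at_vertex v|%:R :> rat by rewrite ler_nat; lia.
nra.
Qed.

(** The critical vertices lie in one set only, a big one. On its boundary, a neighbour outside is
    joined by an edge of [F], whose half pays the due [1 / 2]. *)
Lemma surplus_ge0 v : 0 <= surplus v.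
Proof.
have T1 := T_ge1; have [u0 u1 Tu] := TK_bounds.
have f0 : 0 <= (fdeg v)%:R :> rat by [].
have [/surplus_small|/forall_inPn[p pv /negPn bp]] := boolP (small_at v); first lra.
have [/surplus_ge_free|d1] := leqP 2 #|at_vertex v|; first lra.
have d_eq : #|at_vertex v| = 1%N.
  by apply/eqP; rewrite eqn_leq -ltnS d1 card_gt0; apply/set0Pn; exists p.
have at1 : at_vertex v = [set p].
  by apply/esym/eqP; rewrite eqEcard sub1set pv cards1 d_eq.
have e0 : excess v = 0%N.
  apply/eqP; rewrite -leqn0; apply: leq_trans (excess_le v) _.
  by rewrite d_eq hinge_capS /hinge_cap big_ord0.
rewrite surplusE e0 d_eq at1 big_set1 /due bp.
case: ifP => [|_]; last lra.
rewrite inE => /andP[_ /existsP[w /andP[vw wp]]].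
suff : 1 <= (fdeg v)%:R :> rat by lra.
rewrite ler1n; apply: leq_trans (free_nbrs_le v); rewrite card_gt0.
apply/set0Pn; exists w; rewrite inE vw /=; apply: contraR wp => vwF.
by have [q] := nbr_cover vw vwF; rewrite at1 inE => /eqP ->.
Qed.

Lemma sum_surplus_ge0 (P : pred G) : 0 <= \sum_(v | P v) surplus v.
Proof. by apply: sumr_ge0 => v _; apply: surplus_ge0. Qed.

(** * Summation over all vertices *)

Definition big_members := [set p in members | big p.2].

Lemma small_at_nbig v : (forall p, p \in big_members -> v \notin p.2) -> small_at v.
Proof.
move=> nbig; apply/forall_inP => p; rewrite inE => /andP[pX vp].
by apply: contraL vp => bp; apply: nbig; rewrite inE pX.
Qed.

Lemma sum_due p : p \in members ->
  (if big p.2 then K / 2 else 6 * T) <= \sum_(v in p.2) due p.2 v.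
Proof.
move=> pX; case: ifPn => [bp|sp].
  rewrite (big_setID (boundary p.2)) /= (setIidPr (boundary_sub _)).
  rewrite [X in _ <= _ + X]big1 => [|v]; last first.
    by rewrite inE /due => /andP[/negPf ->].
  rewrite (eq_bigr (fun _ => 1 / 2)) => [|v vb]; last by rewrite /due vb bp.
  rewrite sumr_const -mulr_natl addr0.
  have : K <= #|boundary p.2|%:R by rewrite ler_nat.
  lra.
have [e _] := small_boundary pX sp.
rewrite (eq_bigr (fun _ => 6 * T / #|p.2|%:R)) => [|v vp].
  rewrite sumr_const -[X in _ <= X]mulr_natr divfK // pnatr_eq0.
  by move: pX; rewrite inE => /X_ge5; case: #|_|.
by rewrite /due e vp (negPf sp).
Qed.

Lemma sum_due_ge :
  6 * T * #|members|%:R + (K / 2 - 6 * T) * #|big_members|%:R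
  <= \sum_(p in members) \sum_(v in p.2) due p.2 v.
Proof.
have -> : 6 * T * #|members|%:R + (K / 2 - 6 * T) * #|big_members|%:R
   = \sum_(p in members) (6 * T + (K / 2 - 6 * T) * (big p.2)%:R).
  rewrite big_split sumr_const mulr_natr -mulr_sumr; congr (_ + _ * _).
  rewrite -sum1dep_card natr_sum big_mkcondr; apply: eq_bigr => p _.
  by case: (big _).
apply: ler_sum => p /sum_due; apply: le_trans.
by case: (big _); rewrite ?mulr1n ?mulr0n; lra.
Qed.

(* If only one set [p0] is big, a vertex [z] outside it and its neighbours
   provide the missing [k / 2 - 6 t]: a neighbour joined to [z] by an edge of [F]
   adds to the surplus of [z], and any other neighbour shares a small set with
   [z], hence either avoids [p0] or lies in two sets. *)
Lemma surplus_total :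
  K - 12 * T <= \sum_v surplus v + (K / 2 - 6 * T) * #|big_members|%:R.
Proof.
have T1 := T_ge1; have [u0 u1 Tu] := TK_bounds; have KT := K_ge.
have S0 := sum_surplus_ge0 predT.
(* Each big set overpays its debt by [K / 2 - 6 * T], so two of them suffice. *)
have [B2|] := leqP 2 #|big_members|.
  have : 2 <= #|big_members|%:R :> rat by rewrite ler_nat.
  nra.
case B_eq: #|big_members| => [|[|//]] _.
  (* Without big sets every vertex has surplus at least [1 - 12 * (T / K)], and there are more than
     [k] vertices. *)
  have B0 : big_members = set0 by apply/eqP; rewrite -cards_eq0 B_eq.
  have : \sum_(v : G) (1 - 12 * (T / K)) <= \sum_v surplus v.
    apply: ler_sum => v _; apply/surplus_small/small_at_nbig => p.
    by rewrite B0 inE.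
  rewrite sumr_const -[X in X <= _]mulr_natr mulr0 => le_S.
  have : K <= #|G|%:R by rewrite ler_nat; case: kG => /ltnW.
  move: #|_|%:R le_S => n; set u := T / K in u0 u1 Tu *; nra.
have /eqP/cards1P[p0 B1] := B_eq.
have : p0 \in big_members by rewrite B1 set11.
rewrite inE => /andP[]; rewrite inE => /X_proper; rewrite -subTset.
move=> /subsetPn[z _ zp0] bp0.
have small_z w : w \notin p0.2 -> small_at w.
  by move=> wp0; apply: small_at_nbig => p; rewrite B1 inE => /eqP ->.
pose N := [set w | adj z w & [set z; w] \notin F].
have cN : (k <= fdeg z + #|N|)%N.
  apply: leq_trans (k_connected_degree kG z) _.
  apply: leq_trans (leq_add (free_nbrs_le z) (leqnn _)).
  apply: leq_trans (leq_card_setU _ _); apply: subset_leq_card.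
  by apply/subsetP => w; rewrite !inE => ->; case: (_ \in _).
have surN w : w \in N -> (1 - 12 * (T / K)) / 2 <= surplus w.
  rewrite inE => /andP[zw zwF]; have [q qz wq] := nbr_cover zw zwF.
  have [wp0|/small_z/surplus_small] := boolP (w \in p0.2); last lra.
  apply: surplus_shared; have sub : [set p0; q] \subset at_vertex w.
    apply/subsetP => p; rewrite !inE => /orP[] /eqP ->.
      by rewrite wp0 andbT; move: B1 => /setP/(_ p0); rewrite !inE eqxx => /andP[].
    by rewrite wq andbT; move: qz; rewrite !inE => /andP[].
  apply: leq_trans (subset_leq_card sub); rewrite cards2.
  by case: eqP zp0 qz => // ->; rewrite !inE => /negPf ->; rewrite andbF.
have zN : z \notin N by rewrite inE adj_irrefl.
have : surplus z + \sum_(w in N) surplus w <= \sum_v surplus v.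
  rewrite [X in _ <= X](bigD1 z) //= lerD2l [X in _ <= X](bigID (mem N)) /=.
  rewrite [X in X + _](_ : _ = \sum_(w in N) surplus w).
    by rewrite lerDl sum_surplus_ge0.
  by apply: eq_bigl => w; case: eqP => [->|]; rewrite ?(negPf zN) ?andbT.
have : \sum_(w in N) (1 - 12 * (T / K)) / 2 <= \sum_(w in N) surplus w.
  exact: ler_sum.
rewrite sumr_const -[X in X <= _]mulr_natr.
have := surplus_small_free (small_z z zp0).
move: cN; rewrite -(ler_nat rat) natrD.
set u := T / K in u0 u1 Tu *.
(* At least [K] neighbours of [z] are counted, each worth [(1 - 12 * u) / 2]; together they give
   [K / 2 - 6 * T]. *)
by nra.
Qed.

Lemma handshake (H : {set {set G}}) (f : {set G} -> nat) :
  (forall h, h \in H -> #|h| = 2) ->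
  (\sum_v \sum_(h in H | v \in h) f h = 2 * \sum_(h in H) f h)%N.
Proof.
move=> H2; rewrite (exchange_big_dep (mem H)) //= => [|v h _ /andP[]//].
rewrite big_distrr; apply: eq_bigr => h hH.
rewrite (eq_bigl (mem h)) => [|v]; last by rewrite hH.
by rewrite sum_nat_const H2.
Qed.

Lemma edge_card e : e \in edges G -> #|e| = 2.
Proof.
case/imsetP => -[u v] /= uv ->; rewrite cards2; case: eqP uv => // ->.
by rewrite inE adj_irrefl.
Qed.

Lemma sum_fdeg : (\sum_v fdeg v = 2 * #|F|)%N.
Proof.
rewrite -sum1_card -handshake => [|e /(subsetP F_edges)/edge_card //].
by apply: eq_bigr => v _; rewrite sum1dep_card.
Qed.

Lemma sum_excess :
  (\sum_v excess v = 2 * \sum_j \sum_(h in hinges (X j)) (hinge_deg (X j) h).-1)%N.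
Proof.
rewrite exchange_big big_distrr; apply: eq_bigr => j _ /=.
by apply: handshake => h; rewrite inE => /andP[/eqP].
Qed.

Lemma hinge_deg_gt0 j h : h \in hinges (X j) -> (0 < hinge_deg (X j) h)%N.
Proof.
rewrite inE => /andP[_ /exists_inP[A AX /exists_inP[B _ /andP[_ /eqP <-]]]].
by rewrite card_gt0; apply/set0Pn; exists A; rewrite inE AX subsetIl.
Qed.

(** Summed over vertices, the surplus is the value minus [3 * T * #|G|] with dues in place of the
    debts [6 * T]; [sum_due_ge] compares the two and [surplus_total] concludes. *)
Lemma cover_count :
  3 * T * #|G|%:R + K - 12 * T <= #|F|%:R + T * \sum_j
    (\sum_(A in X j) (3 * #|A|%:R - 6)
      - \sum_(h in hinges (X j)) ((hinge_deg (X j) h)%:R - 1)).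
Proof.
(* Each hinge is counted at both ends. Its degree is positive, so the truncated [.-1] agrees with
   the rational difference. *)
have eX : \sum_j \sum_(h in hinges (X j)) ((hinge_deg (X j) h)%:R - 1)
          = (\sum_v excess v)%:R / 2 :> rat.
  rewrite sum_excess natrM mulrAC divff // mul1r natr_sum.
  apply: eq_bigr => j _; rewrite natr_sum; apply: eq_bigr => h /hinge_deg_gt0.
  by case: (hinge_deg _ _) => // d _; rewrite -natr1 addrK.
have eA : \sum_j \sum_(A in X j) (3 * #|A|%:R - 6)
          = \sum_(p in members) (3 * #|p.2|%:R - 6) :> rat.
  by rewrite pair_big_dep; apply: eq_bigl => p; rewrite inE.
rewrite sumrB eX eA.
have := surplus_total; have := sum_due_ge.
have -> : \sum_v surplus v = (\sum_v fdeg v)%:R / 2 - 3 * T * #|G|%:R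
   + \sum_v \sum_(p in at_vertex v) (3 * T - due p.2 v)
   - T / 2 * (\sum_v excess v)%:R.
  rewrite /surplus sumrB !big_split /= -mulr_suml -mulr_sumr -!natr_sum.
  by rewrite sumr_const -[(- _) *+ _]mulr_natr mulNr.
have -> : \sum_v \sum_(p in at_vertex v) (3 * T - due p.2 v) =
   \sum_(p in members) (3 * T * #|p.2|%:R - \sum_(v in p.2) due p.2 v).
  rewrite (exchange_big_dep (mem members)) /= => [|v p _ /at_members //].
  apply: eq_bigr => p pX; rewrite (eq_bigl (mem p.2)) => [|v].
    by rewrite sumrB sumr_const -[(3 * T) *+ _]mulr_natr.
  by rewrite inE pX.
rewrite sum_fdeg natrM !sumrB sumr_const -!mulr_sumr -[6 *+ _]mulr_natr.
lra.
Qed.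

End CoverCount.

(** * Rank bounds for the cofactor matroid and its unions *)

Section CofactorRank.
Variables (G : sgraph) (C : matroid (edges G)).
Hypothesis cofactorC : is_cofactor_matroid C.
Implicit Types (E F X : {set {set G}}).

Lemma cofactor_valueE F X : ((cofactor_value (F, X))%:~R : rat)%R =
  (#|F|%:R + (\sum_(A in X) (3 * #|A|%:R - 6)
             - \sum_(h in hinges X) ((hinge_deg X h)%:R - 1)))%R.
Proof.
rewrite /cofactor_value addrA !(rmorphB, rmorphD) /= !rmorph_sum.
congr (_ + _ - _)%R; apply: eq_bigr => A _.
  by rewrite !rmorphB rmorphM.
by rewrite rmorphB.
Qed.

Lemma cofactor_rank_le E FX : E \subset edges G -> cofactor_admissible E FX ->
  ((mrank C E)%:Z <= cofactor_value FX)%R.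
Proof.
by move=> sE admE; have [_] := (cofactor_rankP E _).1 (esym (cofactorC sE)); apply.
Qed.

Lemma hinges_set1 (A : {set G}) : hinges [set A] = set0.
Proof.
apply/setP => h; rewrite !inE; apply/negP => /andP[_].
by case/exists_inP=> B /set1P -> /exists_inP[D /set1P ->]; rewrite eqxx.
Qed.

(** The single set [setT] is an admissible cover. *)
Lemma cofactor_rank_max E : 5 <= #|G| -> E \subset edges G ->
  mrank C E + 6 <= 3 * #|G|.
Proof.
move=> G5 sE; have adm : cofactor_admissible E (set0, [set setT]).
  apply/and5P; split; first exact: sub0set.
  - apply/andP; split; apply/forall_inP.
      by move=> A /set1P ->; rewrite cardsT; lia.
    by move=> e _; apply/exists_inP; exists setT; rewrite ?set11 ?subsetT.
  - apply/forall_inP => A /set1P ->; apply/forall_inP => B /set1P ->.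
    by rewrite eqxx.
  - apply/hasP; exists [:: setT]; first by rewrite mem_permutations enum_set1.
    by apply/forallP => -[[|//] ?].
  - by apply/forall_inP => A /set1P ->; rewrite cardsT.
have := cofactor_rank_le sE adm.
by rewrite /cofactor_value hinges_set1 big_set0 big_set1 cards0 cardsT; lia.
Qed.

Lemma union_rank_cover t E : 0 < t -> E \subset edges G ->
  exists2 FX, cofactor_admissible E FX &
    (#|FX.1|%:R + t%:R * (\sum_(A in FX.2) (3 * #|A|%:R - 6)
       - \sum_(h in hinges FX.2) ((hinge_deg FX.2 h)%:R - 1))
    <= (rank_of (union_indep C t) E)%:R :> rat)%R.
Proof.
move=> t_gt0 sE; have [B sBE leB] := union_rank_ge C t E.
have sB := subset_trans sBE sE.
have [[[F X] adm val] _] := (cofactor_rankP B _).1 (esym (cofactorC sB)).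
have /and5P[sF /andP[X2 cov] thin shell X5] := adm.
(* The edges outside [B] join [F]. Counting [F] once instead of [t] times only lowers the left
   side. *)
exists ((E :\: B) :|: F, X).
  apply/and5P; split=> //; first by rewrite subUset subsetDl (subset_trans sF).
  rewrite /is_cover X2 /=; apply/forall_inP => e eE; apply: (forall_inP cov).
  by move: eE; rewrite !inE; case: (e \in B); case: (e \in E); case: (e \in F).
have cF : #|(E :\: B) :|: F| <= #|E :\: B| + #|F| by rewrite (leq_card_setU _ _).
move: val => /(congr1 (fun z : int => (z%:~R : rat)%R)); rewrite cofactor_valueE /=.
move: cF leB t_gt0; rewrite -!(ler_nat rat) !natrD natrM.
have : (0 <= #|F|%:R :> rat)%R by [].
rewrite /=; set a := (\sum_(A in X) _)%R; set b := (\sum_(h in hinges X) _)%R.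
rewrite -[((mrank C B)%:Z)%:~R%R]/((mrank C B)%:R%R).
move=> F0 cF leB t1 val.
have : (#|F|%:R <= t%:R * #|F|%:R :> rat)%R by nra.
have : (t%:R * (mrank C B)%:R = t%:R * #|F|%:R + t%:R * (a - b) :> rat)%R.
  by rewrite -val; ring.
lra.
Qed.

(** Any other set would meet [setT] in at least five vertices. *)
Lemma thin_setT X : two_thin X -> [forall A in X, 5 <= #|A|] ->
  setT \in X -> X = [set setT].
Proof.
move=> /forall_inP thin /forall_inP X5 XT; apply/setP => A; rewrite inE.
apply/idP/eqP => [AX|->//]; apply/eqP; apply: contraT => nAT.
have /forall_inP/(_ setT XT)/implyP/(_ nAT) := thin A AX.
by have := X5 A AX; rewrite setIT; lia.
Qed.

Lemma union_rank_separation k t E1 E2 :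
  0 < t -> 12 * t <= k -> k_connected G k -> E1 :|: E2 = edges G ->
  let r := rank_of (union_indep C t) in
  [\/ 3 * t * #|G| <= r E1 + 6 * t, 3 * t * #|G| <= r E2 + 6 * t
    | 3 * t * #|G| + k <= r E1 + r E2 + 12 * t].
Proof.
move=> t_gt0 le_tk kG EU r.
have sE1 : E1 \subset edges G by rewrite -EU subsetUl.
have sE2 : E2 \subset edges G by rewrite -EU subsetUr.
have [[F1 X1] adm1 le1] := union_rank_cover t_gt0 sE1.
have [[F2 X2] adm2 le2] := union_rank_cover t_gt0 sE2.
have full E F X : cofactor_admissible E (F, X) -> setT \in X ->
    (#|F|%:R + t%:R * (\sum_(A in X) (3 * #|A|%:R - 6)
       - \sum_(h in hinges X) ((hinge_deg X h)%:R - 1)) <= (r E)%:R :> rat)%R ->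
    3 * t * #|G| <= r E + 6 * t.
  move=> /and5P[_ _ thin _ X5] /(thin_setT thin X5) ->.
  rewrite hinges_set1 big_set0 big_set1 cardsT -(ler_nat rat) natrD !natrM.
  by have : (0 <= #|F|%:R :> rat)%R by []; lra.
have [T1|nT1] := boolP (setT \in X1); first by apply: Or31; apply: full adm1 T1 le1.
have [T2|nT2] := boolP (setT \in X2); first by apply: Or32; apply: full adm2 T2 le2.
apply: Or33.
(* The covers of both sides are counted together as one cover of the whole graph, indexed by
   [bool]. *)
pose X (b : bool) := if b then X1 else X2.
have /and5P[sF1 /andP[_ cov1] thin1 shell1 X15] := adm1.
have /and5P[sF2 /andP[_ cov2] thin2 shell2 X25] := adm2.
have thinX b : two_thin (X b) by case: b.
have shellX b : four_shellable (X b) by case: b.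
have X5 b A : A \in X b -> 5 <= #|A|.
  by case: b => AX; [apply: (forall_inP X15) | apply: (forall_inP X25)].
have properX b A : A \in X b -> A != setT.
  by case: b => AX; [apply: contraNneq nT1 | apply: contraNneq nT2] => <-.
have sF : F1 :|: F2 \subset edges G.
  by rewrite subUset (subset_trans sF1) ?(subset_trans sF2).
have cover e : e \in edges G -> e \notin F1 :|: F2 ->
    exists2 p, p.2 \in X p.1 & e \subset p.2.
  rewrite -EU !inE negb_or => /orP[] eE /andP[e1 e2].
    have eEF : e \in E1 :\: F1 by rewrite inE e1.
    have /exists_inP[A AX eA] := forall_inP cov1 e eEF.
    by exists (true, A).
  have eEF : e \in E2 :\: F2 by rewrite inE e2.
  have /exists_inP[A AX eA] := forall_inP cov2 e eEF.
  by exists (false, A).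
have := cover_count t_gt0 le_tk kG thinX shellX X5 properX sF cover.
rewrite big_bool /= => main.
have : (#|F1 :|: F2|%:R <= #|F1|%:R + #|F2|%:R :> rat)%R.
  by rewrite -natrD ler_nat (leq_card_setU _ _).
rewrite -(ler_nat rat) !natrD !natrM.
by move: le1 le2 main => /=; lra.
Qed.

(** The separation bound with an empty second side; the bounds [#|G| >= 13] and [#|G| >= k + 1]
    settle its three cases. *)
Lemma union_rank_ground k t :
  0 < t -> 12 * t <= k -> k_connected G k ->
  k - 6 * t + 1 <= rank_of (union_indep C t) (edges G).
Proof.
move=> t_gt0 le_tk kG; have [ltG _] := kG.
have r0 : rank_of (union_indep C t) set0 = 0.
  apply/eqP; rewrite -leqn0; apply: leq_trans (union_rank_le C t set0) _.
  by have [-> _ _ _] := mrank_rank_fun C; rewrite muln0.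
have := union_rank_separation t_gt0 le_tk kG (setU0 (edges G)).
have tG1 : k + 1 <= t * #|G| by rewrite -[k + 1]mul1n leq_mul ?addn1.
have tG2 : t * 13 <= t * #|G| by rewrite leq_mul //; lia.
by rewrite /= r0 -!mulnA; move: (t * #|G|) (rank_of _ _) tG1 tG2 => n r ? ?; case; lia.
Qed.

Lemma union_rank_max t : 5 <= #|G| ->
  rank_of (union_indep C t) (edges G) + 6 * t <= 3 * t * #|G|.
Proof.
move=> G5; have := union_rank_le C t (edges G).
by have := cofactor_rank_max G5 (subxx _); nia.
Qed.

End CofactorRank.

Theorem theorem4p6 (t k : nat) (G : sgraph) (C : matroid (edges G)) :
  0 < t ->
  12 * t <= k ->
  k_connected G k ->
  is_cofactor_matroid C ->
  vertically_connected (edges G) (rank_of (union_indep C t)) (k - 6 * t + 1).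
Proof.
move=> t_gt0 le_tk kG cofC; apply/vertically_connectedP.
  by move=> A B; apply: rank_of_mono.
split=> [|c ltc]; first exact: union_rank_ground.
apply/negP => /andP[c_gt0 /existsP[E1 /existsP[E2 /and5P[/eqP EU _ c1 c2 le_c]]]].
have G5 : 5 <= #|G| by case: kG => + _; lia.
have := union_rank_max cofC t G5.
have := union_rank_separation cofC t_gt0 le_tk kG EU.
move: c1 c2 le_c; set r := rank_of _ => c1 c2 le_c /=; rewrite -/r -mulnA.
move: (t * #|G|) (r E1) (r E2) (r (edges G)) c1 c2 le_c => n r1 r2 r0 ? ? ?.
(* If one side has the maximal rank, the other has rank below [c]. Otherwise the ranks sum to at
   least [r0 + k - 6 * t], hence to at least [r0 + c]. *)
by case; lia.
Qed.
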